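(* Let $\mathcal{G}$ be a compact metric graph with total length $|\mathcal{G}|=L>0$. Then $$\frac{1}{L}\le \mu_2(\mathcal{G})\,\rho(\mathcal{G}).$$
   Context: A compact metric graph $\mathcal{G}$ is a connected graph with finitely many vertices and edges. Loops and multiple edges are allowed. Each edge is identified with an interval $(0,\ell_e)$ with $\ell_e>0$. The graph carries the shortest-path distance $\operatorname{dist}$ and Lebesgue measure on the edges, and its total length is $|\mathcal{G}|=\sum_e\ell_e$. The mean distance is $\rho(\mathcal{G})=\frac{1}{|\mathcal{G}|^2}\int_{\mathcal{G}}\int_{\mathcal{G}}\operatorname{dist}(x,y)\,\mathrm{d}y\,\mathrm{d}x$. $H^1(\mathcal{G})$ is the space of continuous $L^2$ functions on $\mathcal{G}$ with edgewise derivative in $L^2$. The spectral gap is $$\mu_2(\mathcal{G})=\inf\left\{\frac{\|u'\|_{L^2}^2}{\|u\|_{L^2}^2}: u\in H^1(\mathcal{G}),\ u\ne0,\ \int_{\mathcal{G}}u=0\right\}.$$ *)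

(* Defs.v *)
From HB Require Import structures.
From mathcomp Require Import all_boot all_order all_algebra.
From mathcomp Require Import all_classical all_reals all_analysis.
From mathcomp Require Import lra.

Set Implicit Arguments.
Unset Strict Implicit.
Unset Printing Implicit Defensive.

Import Order.TTheory GRing.Theory Num.Theory.
Import numFieldNormedType.Exports numFieldTopology.Exports.

Local Open Scope classical_set_scope.
Local Open Scope ring_scope.

Definition adjacent (V E : finType) (src tgt : E -> V) : rel V :=
  fun v w => [exists e, ((src e == v) && (tgt e == w)) ||
                        ((src e == w) && (tgt e == v))].

(* [src] and [tgt] only fix the direction in which the edge [e] is identified
   with ]0, len e[; loops and multiple edges are allowed. *)
Record metricGraph (R : realType) := MetricGraph {
  vert : finType;
  edge : finType;
  src : edge -> vert;
  tgt : edge -> vert;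
  len : edge -> R;
  len_gt0 : forall e, 0 < len e;
  graph_connected : forall v w, connect (adjacent src tgt) v w }.

Section Points.
Context {R : realType} (G : metricGraph R).

Definition is_point (p : vert G + edge G * R) : bool :=
  match p with
  | inl _ => true
  | inr (e, t) => 0 < t < len e
  end.

Definition gpoint := {p : vert G + edge G * R | is_point p}.
HB.instance Definition _ := Choice.on gpoint.

Definition vpoint (v : vert G) : gpoint := exist is_point (inl v) isT.

(* The closed edge [e] is the image of [0, len e] under [epoint e]: 0 is sent to
   the vertex [src e], [len e] to [tgt e], and an interior t to the point (e, t)
   ([insubd] falls back on its default [vpoint (src e)] when t <= 0). *)
Definition epoint (e : edge G) (t : R) : gpoint :=
  if len e <= t then vpoint (tgt e)
  else insubd (vpoint (src e)) (inr (e, t)).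

(* A path is a concatenation of segments (e, s, t), each one joining
   [epoint e s] to [epoint e t] inside the closed edge [e]. *)
Fixpoint gpath (x : gpoint) (p : seq (edge G * R * R)) (y : gpoint) : Prop :=
  if p is (e, s, t) :: p' then
    [/\ 0 <= s <= len e, 0 <= t <= len e, x = epoint e s &
        gpath (epoint e t) p' y]
  else x = y.

Definition plength (p : seq (edge G * R * R)) : R :=
  \sum_(a <- p) `|a.2 - a.1.2|.

Definition dist (x y : gpoint) : R :=
  inf [set plength p | p in [set p | gpath x p y]].

Lemma epoint0 e : epoint e 0 = vpoint (src e).
Proof.
rewrite /epoint leNgt len_gt0 /=; apply: val_inj.
by rewrite val_insubd /= ltxx.
Qed.

Lemma epoint_len e : epoint e (len e) = vpoint (tgt e).
Proof. by rewrite /epoint lexx. Qed.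

Lemma val_epoint e t : 0 < t < len e -> val (epoint e t) = inr (e, t).
Proof.
move=> /andP[t0 tl]; rewrite /epoint leNgt tl /= val_insubd /=.
by rewrite t0 tl.
Qed.

Lemma gpointP x :
  (exists v, x = vpoint v) \/ exists e t, 0 < t < len e /\ x = epoint e t.
Proof.
case: x => [[v|[e t]] h]; [left|right]; first by exists v; exact: val_inj.
by exists e, t; split=> //; apply: val_inj; rewrite val_epoint.
Qed.

Lemma plength_cons a p : plength (a :: p) = `|a.2 - a.1.2| + plength p.
Proof. exact: big_cons. Qed.

Lemma plength_ge0 p : 0 <= plength p.
Proof. exact: sumr_ge0. Qed.

Lemma gpath_cat x y z p q :
  gpath x p y -> gpath y q z -> gpath x (p ++ q) z.
Proof.
elim: p x => [x -> //|[[e s] t] p IH x /= [hs ht -> h] hq].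
by split=> //; exact: IH.
Qed.

Lemma plength_cat p q : plength (p ++ q) = plength p + plength q.
Proof. exact: big_cat. Qed.

Lemma gpath_rev x y p : gpath x p y ->
  exists2 q, gpath y q x & plength q = plength p.
Proof.
elim: p x => [x -> |[[e s] t] p IH x /= [hs ht -> /IH[q hq eq]]].
  by exists [::].
exists (q ++ [:: (e, t, s)]); first exact: gpath_cat hq _.
by rewrite plength_cat eq !plength_cons /plength big_nil addr0 /= addrC distrC.
Qed.

Lemma gpath_vert v w : exists p, gpath (vpoint v) p (vpoint w).
Proof.
have /connectP[s + ->] := graph_connected v w.
elim: s v => [|u s IH] v /=; first by exists [::].
move=> /andP[/existsP[e ve] /IH[p hp]].
have l0 := ltW (len_gt0 e).
case/orP: ve => /andP[/eqP ve /eqP ue].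
  exists ((e, 0, len e) :: p) => /=.
  by rewrite !lexx l0 epoint0 epoint_len ve ue.
exists ((e, len e, 0) :: p) => /=.
by rewrite !lexx l0 epoint0 epoint_len ve ue.
Qed.

Lemma gpath_ex x y : exists p, gpath x p y.
Proof.
have tovert z : exists v p, gpath z p (vpoint v).
  case: (gpointP z) => [[v ->]|[e [t [/andP[t0 tl] ->]]]].
    by exists v, [::].
  exists (src e), [:: (e, t, 0)]; rewrite /= epoint0 lexx.
  by split=> //; rewrite ltW ?len_gt0 // ltW.
have [v [p hp]] := tovert x; have [w [q /gpath_rev[q' hq' _]]] := tovert y.
have [r hr] := gpath_vert v w.
by exists (p ++ (r ++ q')); apply: gpath_cat hp _; exact: gpath_cat hr _.
Qed.

Lemma dist_has_inf x y : has_inf [set plength p | p in [set p | gpath x p y]].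
Proof.
split; first by have [p hp] := gpath_ex x y; exists (plength p), p.
by exists 0 => _ [p _ <-]; exact: plength_ge0.
Qed.

Lemma dist_le x y p : gpath x p y -> dist x y <= plength p.
Proof. by move=> h; apply: (ge_inf (dist_has_inf x y).2); exists p. Qed.

Lemma le_dist x y m :
  (forall p, gpath x p y -> m <= plength p) -> m <= dist x y.
Proof.
move=> h; apply: (lb_le_inf (dist_has_inf x y).1) => _ [p hp <-]; exact: h.
Qed.

Lemma dist_ge0 x y : 0 <= dist x y.
Proof. by apply: le_dist => p _; exact: plength_ge0. Qed.

Lemma distxx x : dist x x = 0.
Proof.
apply/eqP; rewrite eq_le dist_ge0 andbT.
have /dist_le : gpath x [::] x by [].
by rewrite /plength big_nil.
Qed.

Lemma dist_sym x y : dist x y = dist y x.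
Proof.
suff h a b : dist a b <= dist b a by apply/eqP; rewrite eq_le !h.
by apply: le_dist => p /gpath_rev[q /dist_le + <-].
Qed.

Lemma dist_triangle y x z : dist x z <= dist x y + dist y z.
Proof.
rewrite -lerBlDr; apply: le_dist => p hp; rewrite lerBlDr -lerBlDl.
apply: le_dist => q hq; rewrite lerBlDl -plength_cat.
by apply: dist_le; exact: gpath_cat hp hq.
Qed.

Lemma dist_epoint e s t : 0 <= s <= len e -> 0 <= t <= len e ->
  dist (epoint e s) (epoint e t) <= `|t - s|.
Proof.
move=> hs ht; have /dist_le : gpath (epoint e s) [:: (e, s, t)] (epoint e t).
  by [].
by rewrite plength_cons /plength big_nil addr0.
Qed.

(* A family of 1-Lipschitz functions on the edges which agree at the vertices
   bounds the distance from below. *)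
Lemma dist_ge_lip (f : gpoint -> R) x y :
  (forall e s t, 0 <= s <= len e -> 0 <= t <= len e ->
     f (epoint e t) - f (epoint e s) <= `|t - s|) ->
  f y - f x <= dist x y.
Proof.
move=> lip; apply: le_dist => p; elim: p x => [x /= ->|[[e s] t] p IH x /=].
  by rewrite subrr plength_ge0.
move=> [hs ht -> /IH h]; rewrite plength_cons /=.
by have := lip _ _ _ hs ht; lra.
Qed.

Lemma epoint_lift (g : vert G -> R) (h : edge G -> R -> R) e t :
  h e 0 = g (src e) -> h e (len e) = g (tgt e) -> 0 <= t <= len e ->
  match val (epoint e t) with inl v => g v | inr (e, t) => h e t end = h e t.
Proof.
move=> h0 hl /andP[]; rewrite le_eqVlt => /predU1P[<- _|t0].
  by rewrite epoint0.
rewrite le_eqVlt => /predU1P[->|tl]; first by rewrite epoint_len.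
by rewrite val_epoint ?t0.
Qed.

Lemma dist_positivity x y : dist x y = 0 -> x = y.
Proof.
move=> d0; apply/eqP; apply/negPn/negP => nxy.
case: (gpointP x) => [[v xv]|[e0 [t0 [/andP[t00 t0l] xe]]]].
- pose d := \big[Num.min/1]_(e : edge G) len e.
  have dgt0 : 0 < d by apply: lt_bigmin => // e _; exact: len_gt0.
  have dle (e : edge G) : d <= len e by exact: bigmin_le.
  pose g w := if w == v then 0 else d.
  pose h (e : edge G) t := Num.min (g (src e) + t) (g (tgt e) + len e - t).
  have g0 w : 0 <= g w by rewrite /g; case: ifP => // _; exact: ltW.
  have gd w : g w <= d by rewrite /g; case: ifP => // _; exact: ltW.
  have h0 (e : edge G) : h e 0 = g (src e).
    rewrite /h addr0 subr0; apply/min_idPl.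
    by have := gd (src e); have := g0 (tgt e); have := dle e; lra.
  have hl (e : edge G) : h e (len e) = g (tgt e).
    rewrite /h addrK; apply/min_idPr.
    by have := gd (tgt e); have := g0 (src e); have := dle e; lra.
  pose f (z : gpoint) :=
    match val z with inl v => g v | inr (e, t) => h e t end.
  have lip (e : edge G) s t : 0 <= s <= len e -> 0 <= t <= len e ->
      f (epoint e t) - f (epoint e s) <= `|t - s|.
    move=> hs ht; rewrite /f !epoint_lift // /h.
    have := ler_norm (t - s); have := ler_norm (s - t); rewrite distrC.
    by rewrite /Num.min; case: ifPn; rewrite -?leNgt; case: ifPn;
       rewrite -?leNgt; lra.
  have := dist_ge_lip x y lip; rewrite d0 subr_le0 leNgt => /negP; apply.
  have -> : f x = 0 by rewrite xv /f /= /g eqxx.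
  case: (gpointP y) => [[w yw]|[e [t [/andP[t0 tl] ye]]]].
    rewrite yw /f /= /g; case: eqP => // wv.
    by move: nxy; rewrite xv yw wv eqxx.
  rewrite ye /f val_epoint ?t0 // /h lt_min.
  by have := g0 (src e); have := g0 (tgt e); lra.
- pose d := Num.min t0 (len e0 - t0).
  have dgt0 : 0 < d by rewrite lt_min t00 subr_gt0.
  have d1 : d <= t0 by rewrite ge_min lexx.
  have d2 : d <= len e0 - t0 by rewrite ge_min lexx orbT.
  pose h (e : edge G) t := if e == e0 then Num.min d `|t - t0| else d.
  have h0 (e : edge G) : h e 0 = d.
    by rewrite /h; case: eqP => // _; apply/min_idPl; rewrite sub0r normrN gtr0_norm.
  have hl (e : edge G) : h e (len e) = d.
    rewrite /h; case: eqP => // ->; apply/min_idPl.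
    by rewrite gtr0_norm // subr_gt0.
  pose f (z : gpoint) :=
    match val z with inl v => d | inr (e, t) => h e t end.
  have lip (e : edge G) s t : 0 <= s <= len e -> 0 <= t <= len e ->
      f (epoint e t) - f (epoint e s) <= `|t - s|.
    move=> hs ht.
    rewrite /f !(@epoint_lift (fun=> d)) // /h; case: eqP => _; last first.
      by rewrite subrr.
    have : `|t - t0| <= `|t - s| + `|s - t0|.
      by rewrite -[in leLHS](subrK s t) -addrA ler_normD.
    have := normr_ge0 (t - s).
    by rewrite /Num.min; case: ifPn; rewrite -?leNgt; case: ifPn;
       rewrite -?leNgt; lra.
  have := dist_ge_lip x y lip; rewrite d0 subr_le0 leNgt => /negP; apply.
  have -> : f x = 0.
    rewrite xe /f val_epoint ?t00 // /h eqxx subrr normr0.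
    by apply/min_idPr; exact: ltW.
  case: (gpointP y) => [[w ->] //|[e [t [/andP[tt0 tl] ye]]]].
  rewrite ye /f val_epoint ?tt0 // /h; case: eqP => // ee.
  rewrite lt_min dgt0 normr_gt0 subr_eq0.
  by apply: contraNneq nxy => tt; rewrite xe ye ee tt.
Qed.

HB.instance Definition _ := isMetric.Build R gpoint
  distxx dist_positivity dist_sym dist_triangle.

Lemma mdistE (x y : gpoint) : mdist x y = dist x y.
Proof. by []. Qed.

End Points.

Section SpectralGap.
Context {R : realType}.
Local Notation mu := (@lebesgue_measure R).

Definition L2 (l : R) (v : R -> R) : Prop :=
  measurable_fun `]0, l[%classic v /\
  mu.-integrable `]0, l[%classic (fun t => (v t ^+ 2)%:E).

(* The functions of class C^1 with compact support in ]0, l[. *)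
Definition test_function (l : R) (phi : R -> R) : Prop :=
  [/\ forall t, derivable phi t 1,
      continuous (derive1 phi) &
      exists a b, [/\ 0 < a, b < l & forall t, ~~ (a <= t <= b) -> phi t = 0]].

Definition weak_derivative (l : R) (u v : R -> R) : Prop :=
  forall phi : R -> R, test_function l phi ->
  \int[mu]_(t in `]0, l[) (u t * derive1 phi t) =
  - \int[mu]_(t in `]0, l[) (v t * phi t).

Variable G : metricGraph R.

Definition total_length : R := \sum_(e : edge G) len e.

Definition eintegral (F : edge G -> R -> R) : R :=
  \sum_(e : edge G) \int[mu]_(t in `]0, len e[) F e t.

(* The vertices form a null set. *)
Definition gintegral (f : gpoint G -> R) : R :=
  eintegral (fun e t => f (epoint e t)).

Definition mean_distance : R :=
  (total_length ^+ 2)^-1 * gintegral (fun x => gintegral (fun y => dist x y)).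

(* [u' e] represents the L^2 class of the derivative of [u] on the edge [e]. *)
Definition edge_derivative (u : gpoint G -> R) (u' : edge G -> R -> R) : Prop :=
  forall e, L2 (len e) (u' e) /\
            weak_derivative (len e) (fun t => u (epoint e t)) (u' e).

Definition H1 (u : gpoint G -> R) : Prop :=
  [/\ continuous u,
      forall e, L2 (len e) (fun t => u (epoint e t)) &
      exists u', edge_derivative u u'].

Definition rayleigh_quotients : set R :=
  [set q | exists (u : gpoint G -> R) (u' : edge G -> R -> R),
    [/\ H1 u, edge_derivative u u', exists x, u x != 0, gintegral u = 0 &
        q = eintegral (fun e t => u' e t ^+ 2) / gintegral (fun x => u x ^+ 2)]].

Definition spectral_gap : \bar R := ereal_inf (EFin @` rayleigh_quotients).

End SpectralGap.

(* Main.v *)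
(* For u of mean zero, 2 L |u|^2 is the double integral of (u x - u y)^2. Along a
   path from x to y whose segments do not overlap, the Cauchy-Schwarz inequality
   gives (u x - u y)^2 <= (length) |u'|^2; since any path can be shortened into
   such a path, (u x - u y)^2 <= dist x y |u'|^2. Integrating over x and y,
   2 L |u|^2 <= L^2 rho |u'|^2, which is twice as good as needed. The
   Cauchy-Schwarz inequality is used in the linear form
   2 |u x - u y| <= lam (length) + |u'|^2 / lam for all lam > 0, which is additive
   along paths. *)
Require Import Defs.
From mathcomp Require Import all_boot all_order all_algebra.
From mathcomp Require Import all_classical all_reals all_analysis.
From mathcomp Require Import measurable_realfun lra ring.

Set Implicit Arguments.
Unset Strict Implicit.
Unset Printing Implicit Defensive.

Import Order.TTheory GRing.Theory Num.Theory.
Import numFieldNormedType.Exports numFieldTopology.Exports.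

Local Open Scope classical_set_scope.
Local Open Scope ring_scope.

(** * Continuity of sums, multiples and squares of real functions *)

Section ContinuousReal.
Context {R : realType} {T : topologicalType}.
Implicit Types f g : T -> R.

Lemma continuous_cst (k : R) : continuous (fun _ : T => k).
Proof. by move=> x; exact: cvg_cst. Qed.

Lemma continuous_add f g :
  continuous f -> continuous g -> continuous (fun x => f x + g x).
Proof. by move=> cf cg x; apply: cvgD; [exact: cf | exact: cg]. Qed.

Lemma continuous_scale k f : continuous f -> continuous (fun x => k * f x).
Proof. by move=> cf x; apply: cvgM; [exact: cvg_cst | exact: cf]. Qed.

Lemma continuous_sqr f : continuous f -> continuous (fun x => f x ^+ 2).
Proof. by move=> cf x; apply: cvgM; exact: cf. Qed.

End ContinuousReal.

(** * A smoothed unit step of class C^1 and its derivative *)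

Section Ramp.
Context {R : realType}.
Local Notation mu := (@lebesgue_measure R).
Implicit Types (a c r x l : R).

Definition pos_part c x : R := Num.max (x - c) 0.

Lemma continuous_pos_part c : continuous (pos_part c).
Proof.
move=> x; apply: (@continuous_max R R (fun x : R => x - c) (fun=> 0)) => /=.
  by apply: cvgB; [exact: cvg_id | exact: cvg_cst].
exact: cvg_cst.
Qed.

(** The first-order remainder is at most [h ^+ 2], even at the kink [x = c], so the difference
    quotient is within [|h|] of the limit. *)
Lemma is_derive_pos_part_sqr c x :
  is_derive x 1 (fun y => pos_part c y ^+ 2) (2 * pos_part c x).
Proof.
have h : (fun h : R => h^-1 *: (pos_part c (h *: 1 + x) ^+ 2 - pos_part c x ^+ 2))
    @ 0^' --> 2 * pos_part c x.
  apply/cvgrPdist_le => e e0; near=> h.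
  have h0 : h != 0 by near: h; exact: nbhs_dnbhs_neq.
  have he : `|h| < e by near: h; exact: dnbhs0_lt.
  have -> : h *: (1 : R) = h by rewrite /GRing.scale /= mulr1.
  rewrite /GRing.scale /=; set A := (X in h^-1 * X).
  have -> : 2 * pos_part c x - h^-1 * A = h^-1 * (h * (2 * pos_part c x) - A).
    by field.
  rewrite normrM normfV ler_pdivrMl ?normr_gt0 //.
  apply: (@le_trans _ _ (`|h| * `|h|)); last by rewrite ler_pM2l ?normr_gt0 ?ltW.
  rewrite -normrM -expr2 (ger0_norm (sqr_ge0 h)) ler_norml /A /pos_part /Num.max.
  by case: ifPn; case: ifPn; rewrite -?leNgt => h1 h2; apply/andP; split; nra.
by apply: DeriveDef; [apply/cvg_ex; exists (2 * pos_part c x) | exact/cvg_lim].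
Unshelve. all: by end_near. Qed.

(* Second difference of the C^1 function [pos_part ^ 2]: it vanishes left of
   a, equals 1 right of a + 2r, and has derivative [tent a r]. *)
Definition ramp a r x : R :=
  (2 * r ^+ 2)^-1 *
  (pos_part a x ^+ 2 - 2 * pos_part (a + r) x ^+ 2 + pos_part (a + 2 * r) x ^+ 2).

(** Hat function of mass 1 with support [a, a + 2r] and peak 1/r at a + r; for small r it acts as an
    approximate identity. *)
Definition tent a r x : R :=
  (r ^+ 2)^-1 *
  (pos_part a x - 2 * pos_part (a + r) x + pos_part (a + 2 * r) x).

Lemma is_derive_ramp a r x : 0 < r -> is_derive x 1 (ramp a r) (tent a r x).
Proof.
move=> r0.
have d c := is_derive_pos_part_sqr c x.
have h := is_deriveZ (2 * r ^+ 2)^-1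
  (is_deriveD (is_deriveB (d a) (is_deriveZ 2 (d (a + r)))) (d (a + 2 * r))).
apply: (is_derive_eq h); rewrite /tent /GRing.scale /=.
by have : r != 0; [rewrite gt_eqF | move=> ?; field].
Qed.

Lemma continuous_tent a r : continuous (tent a r).
Proof.
move=> x; have c := continuous_pos_part.
apply: cvgM; first exact: cvg_cst.
apply: cvgD; last exact: c.
by apply: cvgB; [exact: c | apply: cvgM; [exact: cvg_cst | exact: c]].
Qed.

Lemma ramp_le a r x : x <= a -> 0 < r -> ramp a r x = 0.
Proof.
move=> xa r0; rewrite /ramp /pos_part !max_r; lra.
Qed.

Lemma ramp_ge a r x : 0 < r -> a + 2 * r <= x -> ramp a r x = 1.
Proof.
move=> r0 xa; rewrite /ramp /pos_part !max_l; try lra.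
by have : r != 0 by [rewrite gt_eqF]; move=> ?; field.
Qed.

Lemma ramp_itv a r x : 0 < r -> 0 <= ramp a r x <= 1.
Proof.
move=> r0; rewrite /ramp mulrC.
have r2 : 0 < 2 * r ^+ 2 by nra.
have sq := sqr_ge0 (x - (a + 2 * r)).
rewrite divr_ge0 ?(ltW r2) //= ?ler_pdivrMr // /pos_part /Num.max.
  by case: ifPn => h1; case: ifPn => h2; case: ifPn => h3;
    move: h1 h2 h3; rewrite -?leNgt => h1 h2 h3; try lra; nra.
case: ifPn => h1; case: ifPn => h2; case: ifPn => h3;
  move: h1 h2 h3; rewrite -?leNgt => h1 h2 h3; try lra; try nra.
Qed.

Lemma tent_ge0 a r x : 0 < r -> 0 <= tent a r x.
Proof.
move=> r0; rewrite mulr_ge0 ?invr_ge0 ?sqr_ge0 // /pos_part /Num.max.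
by case: ifPn => h1; case: ifPn => h2; case: ifPn => h3;
  move: h1 h2 h3; rewrite -?leNgt => h1 h2 h3; lra.
Qed.

Lemma tent_out a r x : 0 < r -> (x <= a) || (a + 2 * r <= x) -> tent a r x = 0.
Proof.
move=> r0 h; apply/eqP; rewrite mulf_eq0; apply/orP; right; apply/eqP.
by case/orP: h => h; rewrite /pos_part; [rewrite !max_r | rewrite !max_l]; lra.
Qed.

(** Fundamental theorem of calculus for [ramp a r], which goes from 0 at 0 to 1 at l. *)
Lemma integral_tent a r l : 0 < r -> 0 <= a -> a + 2 * r <= l ->
  \int[mu]_(x in `]0, l[) tent a r x = 1.
Proof.
move=> r0 a0 al.
rewrite /Rintegral -(@integral_itv_bndoo _ 0 l _ true false); last first.
  apply/measurable_EFinP; apply: measurable_funTS.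
  by apply: continuous_measurable_fun; exact: continuous_tent.
have cr y : {for y, continuous (ramp a r)}.
  by apply/differentiable_continuous/derivable1_diffP; case: (@is_derive_ramp a r y r0).
rewrite (@continuous_FTC2 _ _ (ramp a r)).
- by rewrite (ramp_le a0 r0) ramp_ge // sube0.
- by lra.
- by apply: continuous_subspaceT; exact: continuous_tent.
- split.
  + by move=> y _; case: (@is_derive_ramp a r y r0).
  + apply: cvg_at_right_filter; exact: cr.
  + apply: cvg_at_left_filter; exact: cr.
- by move=> y _; rewrite derive1E (derive_val (is_derive := is_derive_ramp a y r0)).
Qed.

End Ramp.

(** * Integrals over a single edge and the bound from the weak derivative *)

Section EdgeIntegrals.
Context {R : realType}.
Local Notation mu := (@lebesgue_measure R).
Implicit Types (l s t e lam : R) (f g v : R -> R).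

Lemma continuous_modulus f t e : continuous f -> 0 < e ->
  exists2 d : R, 0 < d & forall x, `|t - x| < d -> `|f t - f x| <= e.
Proof.
move=> cf e0; have /cvgrPdist_le/(_ _ e0) := cf t.
by move=> /nbhs_ballP[d /= d0 h]; exists d => // x; exact: h.
Qed.

Lemma continuous_integrable l f :
  continuous f -> mu.-integrable `]0, l[%classic (EFin \o f).
Proof.
move=> cf; have ic : mu.-integrable `[0, l]%classic (EFin \o f).
  apply: continuous_compact_integrable; first exact: segment_compact.
  exact: continuous_subspaceT.
by apply: integrableS ic => //; exact: subset_itv_oo_cc.
Qed.

Lemma scale_integrable l k f : mu.-integrable `]0, l[%classic (EFin \o f) ->
  mu.-integrable `]0, l[%classic (EFin \o (fun x => k * f x)).
Proof. by move=> i; have := integrableZl _ k i; apply. Qed.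

Lemma add_integrable l f g : mu.-integrable `]0, l[%classic (EFin \o f) ->
  mu.-integrable `]0, l[%classic (EFin \o g) ->
  mu.-integrable `]0, l[%classic (EFin \o (fun x => f x + g x)).
Proof. by move=> i j; have := integrableD _ i j; apply. Qed.

(** The product is dominated by [v ^+ 2 + g ^+ 2]. *)
Lemma L2_mul_integrable l v g : L2 l v -> continuous g ->
  mu.-integrable `]0, l[%classic (EFin \o (fun x => v x * g x)).
Proof.
move=> [mv iv] cg.
have i := add_integrable iv (continuous_integrable l (continuous_sqr cg)).
apply: (le_integrable _ _ _ i) => //.
  apply/measurable_EFinP; apply: measurable_funM => //.
  by apply: measurable_funTS; exact: continuous_measurable_fun.
move=> x _ /=; rewrite lee_fin (ger0_norm (addr_ge0 (sqr_ge0 _) (sqr_ge0 _))).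
by rewrite ler_norml; apply/andP; split; nra.
Qed.

Lemma sqr_indic_integrable l v (A : set R) : L2 l v -> measurable A ->
  mu.-integrable `]0, l[%classic (EFin \o (fun x => v x ^+ 2 * \1_A x)).
Proof.
move=> [mv iv] mA; apply: le_integrable iv => //.
  apply/measurable_EFinP; apply: measurable_funM.
    exact: measurable_funX.
  exact: measurable_funTS.
move=> x _ /=; rewrite lee_fin normrM ler_piMr // indicE.
by case: (_ \in _); rewrite ?normr0 ?normr1.
Qed.

Lemma indic_integrable l (A : set R) : measurable A ->
  mu.-integrable `]0, l[%classic (EFin \o \1_A).
Proof.
move=> mA; have i := continuous_integrable l (@continuous_cst R R 1).
apply: (le_integrable _ _ _ i) => //.
  by apply/measurable_EFinP; exact: measurable_funTS.
move=> x _ /=; rewrite lee_fin indicE.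
by case: (_ \in _); rewrite ?normr0 ?normr1.
Qed.

Lemma integral_indic_itv l s t : 0 <= s -> s <= t -> t <= l ->
  \int[mu]_(x in `]0, l[) \1_(`]s, t[%classic) x = t - s.
Proof.
move=> s0 st tl; rewrite /Rintegral integral_indic //.
rewrite setIidl; last by apply: subset_itv; rewrite bnd_simp.
have -> : t - s = fine (lebesgue_measure (`]s, t[%classic : set R)); last by [].
rewrite lebesgue_measure_itv /= lte_fin.
by case: ltgtP st => //= -> _; rewrite subrr.
Qed.

(* Test against a smoothed indicator of ]s, t[, whose derivative is the
   difference of two tents concentrated near s and near t. *)
Lemma weak_derivative_bound l f v s t lam :
  continuous f -> L2 l v -> weak_derivative l f v ->
  0 <= s -> s <= t -> t <= l -> 0 < lam ->
  2 * `|f t - f s| <= lam * (t - s) +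
    lam^-1 * \int[mu]_(x in `]0, l[) (v x ^+ 2 * \1_(`]s, t[%classic) x).
Proof.
move=> cf lv wv s0; rewrite le_eqVlt => /predU1P[<-|st] tl lam0.
  rewrite !subrr normr0 !mulr0 add0r mulr_ge0 ?invr_ge0 ?(ltW lam0) //.
  by apply: Rintegral_ge0 => x _; rewrite mulr_ge0 ?sqr_ge0 // indicE.
apply/ler_addgt0Pr => e e0.
have e4 : 0 < e / 4 by lra.
have [d1 d10 h1] := continuous_modulus s cf e4.
have [d2 d20 h2] := continuous_modulus t cf e4.
(* With this r the tents on [s + r, s + 3r] and [t - 3r, t - r] are disjoint, and each lies where f
   varies by at most e/4 from its value at s or t. *)
pose r : R := Num.min (Num.min d1 d2) (t - s) / 8.
have r0 : 0 < r by rewrite divr_gt0 // !lt_min d10 d20 subr_gt0 st.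
have [r1 r2 r3] : [/\ 8 * r <= d1, 8 * r <= d2 & 8 * r <= t - s].
  by rewrite /r mulrC divfK //; split; rewrite !ge_min lexx ?orbT.
(* A tent has mass 1, so the weighted mean of f stays as close to c as f does on the support of the
   tent. *)
have tentE (a c d : R) : 0 <= a -> a + 2 * r <= l ->
    (forall x, a <= x <= a + 2 * r -> `|c - f x| <= d) ->
    `|c - \int[mu]_(x in `]0, l[) (f x * tent a r x)| <= d.
  move=> a0 al h.
  have ct := @continuous_tent R a r.
  have i1 := continuous_integrable l ct.
  have i2 : mu.-integrable `]0, l[%classic (EFin \o (fun x => f x * tent a r x)).
    by apply: continuous_integrable => x; apply: cvgM; [exact: cf | exact: ct].
  have i3 k : mu.-integrable `]0, l[%classic (EFin \o (fun x => k * tent a r x)).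
    by apply: continuous_integrable => x; apply: cvgM; [exact: cvg_cst | exact: ct].
  have E k : \int[mu]_(x in `]0, l[) (k * tent a r x) = k.
    by rewrite RintegralZl // integral_tent // mulr1.
  rewrite distrC ler_distl.
  have le1 x : (c - d) * tent a r x <= f x * tent a r x <= (c + d) * tent a r x.
    have [/andP[ax xa]|] := boolP (a <= x <= a + 2 * r).
      rewrite !ler_wpM2r ?tent_ge0 //; have := h x; rewrite ax xa => /(_ isT);
      by rewrite ler_distl; lra.
    rewrite negb_and -!ltNge => /orP o; rewrite tent_out ?mulr0 ?lexx //.
    by case: o => /ltW ->; rewrite ?orbT.
  apply/andP; split.
    by rewrite -(E (c - d)); apply: le_Rintegral => // x _; case/andP: (le1 x).
  by rewrite -(E (c + d)); apply: le_Rintegral => // x _; case/andP: (le1 x).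
pose phi (x : R) : R := ramp (s + r) r x - ramp (t - 3 * r) r x.
have dphi (x : R) : is_derive x 1 phi (tent (s + r) r x - tent (t - 3 * r) r x).
  by apply: is_deriveB; exact: is_derive_ramp.
have phiE : derive1 phi = fun x : R => tent (s + r) r x - tent (t - 3 * r) r x.
  by apply/funext => x; rewrite derive1E (derive_val (is_derive := dphi x)).
have cphi : continuous phi.
  by move=> x; apply/differentiable_continuous/derivable1_diffP; case: (dphi x).
have phi01 x : 0 <= phi x <= 1.
  rewrite /phi; have [h|h] := leP x (t - 3 * r).
    by rewrite (ramp_le h r0) subr0 ramp_itv.
  rewrite (@ramp_ge _ (s + r)) //; last by lra.
  by have := ramp_itv (t - 3 * r) x r0; lra.
have phi0 x : ~~ (s + r <= x <= t - r) -> phi x = 0.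
  rewrite negb_and -!ltNge /phi => /orP[h|h].
    by rewrite !ramp_le ?subrr //; lra.
  by rewrite !ramp_ge ?subrr //; lra.
have test : test_function l phi.
  split.
  - by move=> x; case: (dphi x).
  - rewrite phiE => x; apply: cvgB; exact: continuous_tent.
  - by exists (s + r), (t - r); split => //; lra.
(* The weak derivative identity becomes [A - B] = minus the integral of [v * phi], where A and B are
   tent means of f near s and t. *)
have := wv _ test; rewrite phiE.
under eq_Rintegral do rewrite mulrBr.
have ic a : mu.-integrable `]0, l[%classic (EFin \o (fun x => f x * tent a r x)).
  by apply: continuous_integrable => x; apply: cvgM; [exact: cf | exact: continuous_tent].
rewrite RintegralB //.
set A := \int[mu]_(x in _) (f x * tent _ r x); set B := \int[mu]_(x in _) (f x * tent _ r x).
move=> AB.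
have hA : `|f s - A| <= e / 4.
  apply: tentE; [lra..|] => x hx; apply: h1; rewrite ltr_norml; lra.
have hB : `|f t - B| <= e / 4.
  apply: tentE; [lra..|] => x hx; apply: h2; rewrite ltr_norml; lra.
(* Pointwise, [2 * |v * phi| <= lam + lam^-1 * v ^+ 2] on ]s, t[ because [0 <= phi <= 1], and phi
   vanishes elsewhere. *)
have key : 2 * `|A - B| <= lam * (t - s) +
    lam^-1 * \int[mu]_(x in `]0, l[) (v x ^+ 2 * \1_(`]s, t[%classic) x).
  rewrite AB normrN.
  have ivp := L2_mul_integrable lv cphi.
  have i1 := indic_integrable l (measurable_itv `]s, t[).
  have i2 := sqr_indic_integrable lv (measurable_itv `]s, t[).
  apply: (@le_trans _ _ (2 * \int[mu]_(x in `]0, l[) `|v x * phi x|)).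
    by rewrite ler_pM2l // le_normr_Rintegral.
  rewrite -(integral_indic_itv s0 (ltW st) tl) -!RintegralZl //; last first.
    exact: integrable_norm.
  rewrite -RintegralD //; [|exact: scale_integrable..].
  apply: le_Rintegral => //.
  - by apply: scale_integrable; exact: integrable_norm.
  - by apply: add_integrable; exact: scale_integrable.
  move=> x _; rewrite indicE.
  have [xst|xst] := boolP (x \in `]s, t[%classic); last first.
    rewrite phi0 ?mulr0 ?normr0 ?mulr0 ?addr0 //.
    apply: contra xst => hx; rewrite inE /= in_itv /=; lra.
  rewrite !mulr1.
  have -> : lam + lam^-1 * v x ^+ 2 = lam^-1 * (lam ^+ 2 + `|v x| ^+ 2).
    by rewrite real_normK ?num_real //; field; rewrite gt_eqF.
  rewrite ler_pdivlMl // normrM.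
  have /andP[p0 p1] := phi01 x; rewrite (ger0_norm p0).
  have a0 := normr_ge0 (v x).
  have sq := sqr_ge0 (lam - `|v x|).
  have : lam * (`|v x| * phi x) <= lam * `|v x|.
    by rewrite ler_pM2l // ler_piMr.
  nra.
have : `|f t - f s| <= `|f t - B| + `|A - B| + `|f s - A|.
  have -> : f t - f s = (f t - B) - (A - B) - (f s - A) by lra.
  by rewrite (le_trans (ler_normB _ _)) // lerD2r ler_normB.
by lra.
Qed.

(** By continuity f is at least [f t / 2] on a short interval next to t. *)
Lemma integral_gt0 l f t :
  continuous f -> (forall x, 0 <= f x) -> 0 < l -> 0 <= t <= l -> 0 < f t ->
  0 < \int[mu]_(x in `]0, l[) f x.
Proof.
move=> cf f0 l0 /andP[t0 tl] ft.
have ft2 : 0 < f t / 2 by rewrite divr_gt0.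
have [d d0 h] := continuous_modulus t cf ft2.
pose r : R := Num.min d l / 4.
have r0 : 0 < r by rewrite divr_gt0 // lt_min d0.
have [rd rl] : 4 * r <= d /\ 4 * r <= l.
  by rewrite /r mulrC divfK //; split; rewrite ge_min lexx ?orbT.
(* The interval extends from t towards the middle, so it stays in [0, l] even when t is an
   endpoint. *)
pose a : R := if t <= l / 2 then t else t - r.
have [a0 al at1 at2] : [/\ 0 <= a, a + r <= l, a <= t & t <= a + r].
  by rewrite /a; case: (leP t (l / 2)) => ?; split; lra.
have ar : a <= a + r by lra.
have i1 := scale_integrable (f t / 2) (indic_integrable l (measurable_itv `]a, (a + r)[)).
apply: (@lt_le_trans _ _ (f t / 2 * r)); first by rewrite mulr_gt0.
have {1}-> : r = (a + r) - a by lra.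
rewrite -(integral_indic_itv a0 ar al) -RintegralZl //; last exact: indic_integrable.
apply: le_Rintegral => //; first exact: continuous_integrable.
move=> x _; rewrite indicE; have [|_] := boolP (x \in _); last by rewrite mulr0.
rewrite inE /= in_itv /= => /andP[ax xa]; rewrite mulr1.
have : `|t - x| < d by rewrite ltr_norml; lra.
by move=> /h; rewrite ler_norml; lra.
Qed.

End EdgeIntegrals.

(** * Shortening paths until their segments do not overlap *)

Section PathReduction.
Context {R : realType} (G : metricGraph R).
Implicit Types (a b : edge G * R * R) (p q : seq (edge G * R * R)).

(** Strict inequalities allow segments of one edge to share an endpoint. *)
Definition overlap a b : bool :=
  [&& a.1.1 == b.1.1, Num.min a.1.2 a.2 < Num.max b.1.2 b.2 &
      Num.min b.1.2 b.2 < Num.max a.1.2 a.2].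

Definition segment_set a : set R :=
  `]Num.min a.1.2 a.2, Num.max a.1.2 a.2[%classic.

(** The weight that turns the sum of segment energies along a path into one integral over the
    graph. *)
Definition multiplicity p (e : edge G) (t : R) : R :=
  \sum_(a <- p) if a.1.1 == e then \1_(segment_set a) t else 0.

Lemma multiplicity_cons a p e t : multiplicity (a :: p) e t =
  (if a.1.1 == e then \1_(segment_set a) t else 0) + multiplicity p e t.
Proof. exact: big_cons. Qed.

Lemma multiplicity_ge0 p e t : 0 <= multiplicity p e t.
Proof. by apply: sumr_ge0 => a _; case: ifP => // _; rewrite indicE. Qed.

(** A point interior to two segments would make them overlap. *)
Lemma multiplicity_le1 p e t :
  pairwise (fun a b => ~~ overlap a b) p -> multiplicity p e t <= 1.
Proof.
rewrite /multiplicity; elim: p => [|a p IH] /=; first by rewrite big_nil.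
rewrite big_cons => /andP[ap /IH h].
case: eqP => ae; last by rewrite add0r.
rewrite indicE; have [|_] := boolP (t \in segment_set a); last by rewrite add0r.
rewrite inE /segment_set /= in_itv /= => /andP[ta at'].
rewrite big1_seq ?addr0 // => b /andP[_ bp].
case: eqP => be //; rewrite indicE; case: (boolP (t \in _)) => //.
rewrite inE /segment_set /= in_itv /= => /andP[tb bt].
have /allP/(_ _ bp) := ap; rewrite /overlap ae be eqxx /=.
by rewrite (lt_trans ta bt) (lt_trans tb at').
Qed.

(* Two overlapping segments of a path, together with the part of the path
   between them, can be replaced by a single segment which is not longer. *)
Lemma gpath_reduce (x y : gpoint G) p : gpath x p y ->
  exists q, [/\ gpath x q y, plength q <= plength p &
                pairwise (fun a b => ~~ overlap a b) q].
Proof.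
(* The size bound on [q] lets the induction hypothesis apply twice: to the tail, then to the path
   obtained by a shortcut. *)
suff h n : forall x p, (size p <= n)%N -> gpath x p y -> exists q,
    [/\ (size q <= size p)%N, gpath x q y, plength q <= plength p &
        pairwise (fun a b => ~~ overlap a b) q].
  by move=> /(h _ _ _ (leqnn _))[q [_ ? ? ?]]; exists q.
elim: n => [|n IH] {}x {}p; first by rewrite leqn0 => /nilP -> hp; exists [::].
case: p => [_ hp|[[e s] t] p]; first by exists [::].
rewrite /= ltnS => pn [hs ht xs /(IH _ _ pn)[q [qp hq lq sq]]].
have [/hasP[b bq ab]|] := boolP (has (overlap (e, s, t)) q); last first.
  rewrite -all_predC => h; exists ((e, s, t) :: q); split => //.
  - by rewrite !plength_cons lerD2l.
  - by rewrite /= sq andbT; apply/allP => b /(allP h).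
move: ab; case: b bq => [[e' s'] t'] bq /and3P[/= /eqP ee m1 m2].
case/splitPr: bq hq lq qp {sq} => q1 q2 hq lq qp.
have [ht' hq2] : 0 <= t' <= len e /\ gpath (epoint e t') q2 y.
  have : exists z, gpath z ((e', s', t') :: q2) y.
    elim: q1 {lq qp} (epoint e t) hq => [z hz|[[e1 s1] t1] q1 IHq z /= [_ _ _ /IHq //]].
    by exists z.
  by rewrite -ee => -[z [_ ? _ ?]].
(* The shortcut runs inside the edge from s directly to t', dropping [q1]; the new path has no more
   segments than the tail had. *)
have [||r [rs hr lr pr]] := IH x ((e, s, t') :: q2).
- by apply: leq_trans pn; apply: leq_trans qp; rewrite size_cat /= leq_addl.
- by [].
exists r; split => //.
- apply: (leq_trans rs); rewrite /= ltnS; apply: leq_trans qp.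
  by rewrite size_cat /= -addSnnS leq_addl.
- apply: le_trans lr _; rewrite !plength_cons /=.
  move: lq; rewrite plength_cat plength_cons /=.
  have := plength_ge0 q1.
  (* The union of the two overlapping segments is an interval containing s and t', so their lengths
     add up to at least the distance between these. *)
  have : `|t' - s| <= `|t - s| + `|t' - s'|.
    move: m1 m2; rewrite !lt_max !gt_min.
    rewrite ler_norml.
    have := ler_norm (t - s); have := ler_norm (s - t); rewrite (distrC s t).
    have := ler_norm (t' - s'); have := ler_norm (s' - t'); rewrite (distrC s' t').
    lra.
  lra.
Qed.

End PathReduction.

(** * Continuity and integration on the graph *)

Section GraphIntegrals.
Context {R : realType} (G : metricGraph R).
Local Notation mu := (@lebesgue_measure R).
Implicit Types (f g u : gpoint G -> R).

(** The default value of [insubd] makes [epoint e] constant to the left of 0. Clamping extends the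
    Lipschitz bound to all reals, so functions read on an edge are continuous on the whole line. *)
Lemma epoint_clamp (e : edge G) t :
  epoint e t = epoint e (Num.min (Num.max t 0) (len e)).
Proof.
have l0 := len_gt0 e; have [t0|t0] := leP t 0.
  rewrite min_l ?ltW // epoint0 /epoint leNgt (le_lt_trans t0 l0) /=.
  by apply: val_inj; rewrite val_insubd /= ltNge t0.
have [tl|tl] := leP t (len e); first by [].
by rewrite epoint_len /epoint (ltW tl).
Qed.

Lemma dist_epoint_le (e : edge G) s t : dist (epoint e s) (epoint e t) <= `|t - s|.
Proof.
rewrite (epoint_clamp e s) (epoint_clamp e t).
have l0 := ltW (len_gt0 e).
apply: le_trans (dist_epoint _ _) _; rewrite ?le_min ?ge_min ?le_max ?lexx ?l0 ?orbT //.
have := ler_norm (t - s); have := ler_norm (s - t); rewrite (distrC s t) ler_norml.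
rewrite /Num.min /Num.max; case: (ltP t 0) => h1; case: (ltP s 0) => h2;
  do 2?case: (ltP _ (len e)) => ?; lra.
Qed.

Lemma continuous_epoint u (e : edge G) :
  continuous u -> continuous (fun t => u (epoint e t)).
Proof.
move=> cu t; apply: (@continuous_comp _ _ _ (epoint e) u); last exact: cu.
apply/cvg_ballP => r r0; apply/nbhs_ballP; exists r => //= s ts.
rewrite ballEmdist /=; apply: le_lt_trans (dist_epoint_le _ _ _) _.
by rewrite distrC.
Qed.

Lemma lipschitz_gpoint_continuous f k :
  (forall x y, f y - f x <= k * dist x y) -> continuous f.
Proof.
move=> lip x; apply/(cvgrPdist_lt (FF := nbhs_filter x)) => r r0; apply/nbhs_ballP.
(* The sign of k is arbitrary; [|k| + 1] is a positive Lipschitz constant. *)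
have k0 : 0 < `|k| + 1 by have := normr_ge0 k; lra.
exists (r / (`|k| + 1)); first by rewrite /= divr_gt0.
move=> y; rewrite ballEmdist /= ltr_pdivlMr // => xy.
have {}xy : dist x y * (`|k| + 1) < r by [].
have := dist_ge0 x y; have := lip x y; have := lip y x; rewrite (dist_sym y x).
have := ler_norm k; rewrite ltr_norml; nra.
Qed.

Lemma dist_continuous (x : gpoint G) : continuous (dist x).
Proof.
apply: (@lipschitz_gpoint_continuous _ 1) => y z.
by have := dist_triangle y x z; lra.
Qed.

Lemma edge_integrable f (e : edge G) : continuous f ->
  mu.-integrable `]0, len e[%classic (EFin \o (fun t => f (epoint e t))).
Proof. by move=> cf; exact/continuous_integrable/continuous_epoint. Qed.

Lemma gintegralD f g : continuous f -> continuous g ->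
  gintegral (fun x => f x + g x) = gintegral f + gintegral g.
Proof.
move=> cf cg; rewrite /gintegral /eintegral -big_split /=; apply: eq_bigr => e _.
by rewrite RintegralD //; exact: edge_integrable.
Qed.

Lemma gintegralZl k f : continuous f ->
  gintegral (fun x => k * f x) = k * gintegral f.
Proof.
move=> cf; rewrite /gintegral /eintegral mulr_sumr; apply: eq_bigr => e _.
by rewrite RintegralZl //; exact: edge_integrable.
Qed.

Lemma gintegral_cst k : gintegral (fun _ : gpoint G => k) = k * total_length G.
Proof.
rewrite /gintegral /eintegral mulr_sumr; apply: eq_bigr => e _.
rewrite Rintegral_cst //.
have -> : fine (mu `]0, len e[%classic) =
    fine (lebesgue_measure (`]0, len e[%classic : set R)) by [].
by rewrite lebesgue_measure_itv /= lte_fin len_gt0 /= subr0.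
Qed.

Lemma le_gintegral f g : continuous f -> continuous g ->
  (forall x, f x <= g x) -> gintegral f <= gintegral g.
Proof.
move=> cf cg fg; apply: ler_sum => e _.
by apply: le_Rintegral => //; exact: edge_integrable.
Qed.

Lemma edge_inhabited : 0 < total_length G -> inhabited (edge G).
Proof.
move=> L0; apply: contrapT => h; move: L0.
by rewrite /total_length big1 ?ltxx // => e; case: h.
Qed.

(** Positive length provides an edge, and connectedness then gives every vertex an incident edge:
    the first one on a walk to [src e0], or [e0] itself. *)
Lemma point_on_edge (x : gpoint G) : 0 < total_length G ->
  exists e t, 0 <= t <= len e /\ x = epoint e t.
Proof.
move=> L0; have [[v ->]|[e [t [/andP[t0 tl] ->]]]] := gpointP x; last first.
  by exists e, t; rewrite !ltW.
have [e0] := edge_inhabited L0.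
have ends (e : edge G) : [\/ v = src e | v = tgt e] ->
    exists e t, 0 <= t <= len e /\ vpoint v = epoint e t.
  have l0 := ltW (len_gt0 e).
  case=> ->; [exists e, 0 | exists e, (len e)].
    by rewrite lexx l0 epoint0.
  by rewrite lexx l0 epoint_len.
have /connectP[[/= _ ve|w p /= /andP[/existsP[e ad] _] _]] := graph_connected v (src e0).
  by apply: (ends e0); left.
by case/orP: ad => /andP[/eqP h1 /eqP h2]; apply: (ends e); [left|right].
Qed.

Lemma gintegral_gt0 f x : 0 < total_length G -> continuous f ->
  (forall y, 0 <= f y) -> 0 < f x -> 0 < gintegral f.
Proof.
move=> L0 cf f0; have [e [t [tl ->]]] := point_on_edge x L0 => fx.
rewrite /gintegral /eintegral (bigD1 e) //= ltr_pwDl //.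
  by apply: (integral_gt0 (t := t)) => //; [exact: continuous_epoint | exact: len_gt0].
by apply: sumr_ge0 => e' _; exact: Rintegral_ge0.
Qed.

(** Integrating the triangle inequality gives the Lipschitz constant [total_length G]. *)
Lemma integral_dist_continuous :
  continuous (fun x : gpoint G => gintegral (dist x)).
Proof.
apply: (@lipschitz_gpoint_continuous _ (total_length G)) => x y.
rewrite lerBlDr mulrC -gintegral_cst -gintegralD; last 2 first.
- exact: continuous_cst.
- exact: dist_continuous.
apply: le_gintegral => [||z].
- exact: dist_continuous.
- by apply: continuous_add; [exact: continuous_cst | exact: dist_continuous].
- by rewrite (dist_sym x y) dist_triangle.
Qed.

End GraphIntegrals.

(** * From energy along paths to a Poincaré inequality *)

Section EnergyBound.
Context {R : realType} (G : metricGraph R).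
Local Notation mu := (@lebesgue_measure R).
Variables (u : gpoint G -> R) (u' : edge G -> R -> R).
Implicit Types (s t lam : R).
Hypotheses (cu : continuous u) (du : edge_derivative u u').

Let energy := eintegral (fun e t => u' e t ^+ 2).

Lemma segment_integrable (a : edge G * R * R) e :
  mu.-integrable `]0, len e[%classic (EFin \o (fun t =>
    u' e t ^+ 2 * (if a.1.1 == e then \1_(segment_set a) t else 0))).
Proof.
case: eqP => _; first by apply: (sqr_indic_integrable (proj1 (du e))); exact: measurable_itv.
apply: continuous_integrable; under eq_fun do rewrite mulr0.
exact: continuous_cst.
Qed.

Lemma multiplicity_integrable p e : mu.-integrable `]0, len e[%classic
  (EFin \o (fun t => u' e t ^+ 2 * multiplicity p e t)).
Proof.
elim: p => [|a p IH].
  apply: continuous_integrable; under eq_fun do rewrite /multiplicity big_nil mulr0.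
  exact: continuous_cst.
rewrite (_ : (fun t => _) = (fun t =>
    u' e t ^+ 2 * (if a.1.1 == e then \1_(segment_set a) t else 0) +
    u' e t ^+ 2 * multiplicity p e t)).
  by apply: add_integrable => //; exact: segment_integrable.
by apply/funext => t; rewrite multiplicity_cons mulrDr.
Qed.

Lemma eintegral_multiplicity_cons e s t p :
  eintegral (fun e' x => u' e' x ^+ 2 * multiplicity ((e, s, t) :: p) e' x) =
  \int[mu]_(x in `]0, len e[) (u' e x ^+ 2 * \1_(segment_set (e, s, t)) x) +
  eintegral (fun e' x => u' e' x ^+ 2 * multiplicity p e' x).
Proof.
(* Padding with zero terms on the other edges lets the two sums be merged edge by edge. *)
have -> : \int[mu]_(x in `]0, len e[) (u' e x ^+ 2 * \1_(segment_set (e, s, t)) x) =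
    \sum_(e' : edge G) \int[mu]_(x in `]0, len e'[)
      (u' e' x ^+ 2 * (if e == e' then \1_(segment_set (e, s, t)) x else 0)).
  rewrite (bigD1 e) //= eqxx big1 ?addr0 // => e' /negbTE ne.
  under eq_Rintegral do rewrite eq_sym ne mulr0.
  by rewrite Rintegral_cst // mul0r.
rewrite /eintegral -big_split /=; apply: eq_bigr => e' _.
rewrite -RintegralD //; last 2 first.
- exact: (segment_integrable (e, s, t)).
- exact: multiplicity_integrable.
by apply: eq_Rintegral => x _; rewrite multiplicity_cons mulrDr.
Qed.

Lemma segment_energy_bound e s t lam : 0 < lam ->
  0 <= s <= len e -> 0 <= t <= len e ->
  2 * `|u (epoint e t) - u (epoint e s)| <= lam * `|t - s| +
    lam^-1 * \int[mu]_(x in `]0, len e[) (u' e x ^+ 2 * \1_(segment_set (e, s, t)) x).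
Proof.
move=> lam0 /andP[s0 sl] /andP[t0 tl]; have [l2 wd] := du e.
have ce : continuous (fun x => u (epoint e x)) by exact: continuous_epoint.
rewrite /segment_set /=; have [st|ts] := leP s t.
  have := weak_derivative_bound ce l2 wd s0 st tl lam0.
  by rewrite (ger0_norm (_ : 0 <= t - s)) ?subr_ge0.
have := weak_derivative_bound ce l2 wd t0 (ltW ts) sl lam0.
by rewrite distrC (distrC t s) (ger0_norm (_ : 0 <= s - t)) // subr_ge0 ltW.
Qed.

(** The segment bounds add up by the triangle inequality; overlapping segments are counted with
    multiplicity. *)
Lemma path_energy_bound x y p lam : 0 < lam -> gpath x p y ->
  2 * `|u y - u x| <= lam * plength p +
    lam^-1 * eintegral (fun e t => u' e t ^+ 2 * multiplicity p e t).
Proof.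
move=> lam0; elim: p x => [x /= ->|[[e s] t] p IH x /= [hs ht -> /IH h]].
  rewrite subrr normr0 mulr0 addr_ge0 ?mulr_ge0 ?plength_ge0 ?invr_ge0 ?(ltW lam0) //.
  apply: sumr_ge0 => e _; apply: Rintegral_ge0 => t _.
  by rewrite mulr_ge0 ?sqr_ge0 ?multiplicity_ge0.
rewrite plength_cons eintegral_multiplicity_cons /= !mulrDr.
have := segment_energy_bound lam0 hs ht.
have : `|u y - u (epoint e s)| <=
    `|u y - u (epoint e t)| + `|u (epoint e t) - u (epoint e s)|.
  by rewrite -[in leLHS](subrK (u (epoint e t)) (u y)) -addrA ler_normD.
by lra.
Qed.

(** A reduced path has multiplicity at most 1, so its energy is at most [energy]. Taking the infimum
    over paths and then the best [lam] gives the square form. *)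
Lemma dist_energy_bound x y : (u x - u y) ^+ 2 <= energy * dist x y.
Proof.
have key lam : 0 < lam -> 2 * `|u y - u x| <= lam * dist x y + lam^-1 * energy.
  move=> lam0; rewrite -lerBlDr -ler_pdivrMl //; apply: le_dist => p.
  move=> /gpath_reduce[q [hq lq sq]]; apply: le_trans lq.
  rewrite ler_pdivrMl // lerBlDr; apply: le_trans (path_energy_bound lam0 hq) _.
  rewrite lerD2l ler_pM2l ?invr_gt0 //; apply: ler_sum => e _.
  apply: le_Rintegral => //; first exact: multiplicity_integrable.
    by case: (du e) => -[].
  by move=> t _; rewrite ler_piMr ?sqr_ge0 ?multiplicity_le1.
rewrite -(real_normK (num_real (u x - u y))) distrC.
(* The choice of [lam] below needs [dist x y] and [|u y - u x|] positive; the zero cases are settled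
   first. *)
have [d0|] := eqVneq (dist x y) 0.
  by rewrite (dist_positivity d0) subrr normr0 distxx mulr0 expr0n.
rewrite neq_lt ltNge dist_ge0 /= => d0.
have := normr_ge0 (u y - u x); rewrite le_eqVlt => /predU1P[<-|A0].
  rewrite expr0n /= mulr_ge0 ?dist_ge0 //.
  by apply: sumr_ge0 => e _; apply: Rintegral_ge0 => t _; exact: sqr_ge0.
(* [lam = A / dist x y] balances the two terms of [key]. *)
have := key _ (divr_gt0 A0 d0); set A := `|_| in A0 *.
rewrite divfK ?gt_eqF // invf_div => h.
have : A <= dist x y / A * energy by lra.
by rewrite mulrAC ler_pdivlMr // -expr2 mulrC.
Qed.

Lemma poincare_mean_distance : 0 < total_length G -> gintegral u = 0 ->
  2 * gintegral (fun x => u x ^+ 2) <=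
  energy * (total_length G * mean_distance G).
Proof.
set L := total_length G => L0 u0.
pose S := gintegral (fun x => u x ^+ 2).
pose m (x : gpoint G) := gintegral (fun y => dist x y).
have cu2 := continuous_sqr cu.
have cst_c := @continuous_cst R (gpoint G).
have cd x := @dist_continuous _ G x.
have cm : continuous m by exact: integral_dist_continuous.
(* Integration in y of the bound on [(u x - u y) ^+ 2]; the cross term vanishes since u has mean
   zero. *)
have inner x : L * u x ^+ 2 + S <= energy * m x.
  rewrite -gintegralZl //.
  have <- : gintegral (fun y => u x ^+ 2 + (- 2 * u x * u y + u y ^+ 2)) =
      L * u x ^+ 2 + S.
    rewrite gintegralD ?gintegralD ?gintegralZl ?gintegral_cst //; last 2 first.
    - exact: continuous_scale.
    - by apply: continuous_add => //; exact: continuous_scale.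
    by rewrite u0 /S /L; ring.
  apply: le_gintegral => [||y].
  - by apply: continuous_add => //; apply: continuous_add => //; exact: continuous_scale.
  - exact: continuous_scale.
  by apply: le_trans (dist_energy_bound x y); rewrite le_eqVlt; apply/orP; left; apply/eqP; ring.
have : gintegral (fun x => L * u x ^+ 2 + S) <= gintegral (fun x => energy * m x).
  by apply: le_gintegral => //; [apply: continuous_add => //|]; exact: continuous_scale.
rewrite gintegralD ?gintegralZl ?gintegral_cst //; last exact: continuous_scale.
rewrite -/S -/L => h.
(* The factor [L ^- 2] in [mean_distance] leaves one [L^-1], which cancels against the left side
   [2 * L * S] of [h]. *)
have -> : energy * (L * mean_distance G) = L^-1 * (energy * gintegral m).
  by rewrite /mean_distance -/L -/m; field; rewrite gt_eqF.
by rewrite ler_pdivlMl //; apply: le_trans h; rewrite le_eqVlt; apply/orP; left; apply/eqP; ring.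
Qed.

End EnergyBound.

(** * Positivity of the mean distance and the lower bound for the spectral gap *)

Lemma mean_distance_gt0 (R : realType) (G : metricGraph R) :
  0 < total_length G -> 0 < mean_distance G.
Proof.
move=> L0; rewrite /mean_distance mulr_gt0 ?invr_gt0 ?exprn_gt0 //.
have [e] := edge_inhabited L0.
have el : 0 < len e / 2 < len e by have := len_gt0 e; lra.
(* An edge's source and midpoint are distinct; strict positivity then passes through the inner and
   the outer integral. *)
have d0 : 0 < dist (vpoint (src e)) (epoint e (len e / 2)).
  rewrite lt0r dist_ge0 andbT; apply/eqP => /dist_positivity /(congr1 val).
  by rewrite val_epoint.
have m0 := gintegral_gt0 L0 (@dist_continuous _ _ _) (dist_ge0 _) d0.
apply: (gintegral_gt0 L0 (@integral_dist_continuous _ G) _ m0) => x.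
by apply: sumr_ge0 => e' _; apply: Rintegral_ge0 => t _; exact: dist_ge0.
Qed.

(** [poincare_mean_distance] with its factor 2 weakened to 1, divided by the positive squared norm
    of u. *)
Lemma rayleigh_quotient_ge (R : realType) (G : metricGraph R) q :
  0 < total_length G -> rayleigh_quotients G q ->
  (total_length G * mean_distance G)^-1 <= q.
Proof.
move=> L0 [u [u' [[cu _ _] du [x ux] u0 ->]]].
have rho0 := mean_distance_gt0 L0.
have S0 : 0 < gintegral (fun x => u x ^+ 2).
  apply: (gintegral_gt0 (x := x) L0 (continuous_sqr cu)) => [y|].
    exact: sqr_ge0.
  by rewrite exprn_even_gt0.
rewrite ler_pdivlMr // ler_pdivrMl; last exact: mulr_gt0 L0 rho0.
by have := poincare_mean_distance cu du L0 u0; rewrite mulrC; lra.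
Qed.

Local Close Scope classical_set_scope.
Local Open Scope ereal_scope.

Theorem theorem3p5 (R : realType) (G : metricGraph R) (L : R)
    (hL : total_length G = L) (L_gt0 : (0 < L)%R) :
  (1 / L)%:E <= spectral_gap G * (mean_distance G)%:E.
Proof.
move: L_gt0; rewrite -{}hL => L0; have rho0 := mean_distance_gt0 L0.
(* Factoring out the positive mean distance reduces the claim to a lower bound for the infimum,
   hence for each Rayleigh quotient. *)
have -> : (1 / total_length G)%:E =
    ((total_length G * mean_distance G)^-1)%:E * (mean_distance G)%:E.
  by rewrite -EFinM invfM mulrAC mulfK ?gt_eqF // div1r.
apply: lee_wpmul2r; first by rewrite lee_fin ltW.
by apply/ereal_infP => _ [q /(rayleigh_quotient_ge L0) h <-]; rewrite lee_fin.
Qed.
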